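(* Let $p$ be a prime, let $n\ge 0$ and $k\ge 0$ be integers, and let $a\in\mathbb{Z}_p$. For $x=a+p^n u$ with $u$ a variable, $\delta^k x$ is a polynomial in $u$ with coefficients in $\mathbb{Q}_p$ of degree at most $p^k$; write $\delta^k(a+p^n u)=\sum_{j=0}^{p^k} c^k_{a,j}u^j$ with $c^k_{a,j}\in\mathbb{Q}_p$. Then: (1) $|c^k_{a,0}|_p\le 1$; (2) $|c^k_{a,1}|_p=p^{-(n-k)}$; (3) $|c^k_{a,j}|_p\le p^{-((n-k+1)j-1)}$ for $2\le j\le p^k$.
   Context: $\mathbb{Q}_p$ is the field of $p$-adic numbers with $p$-adic norm $|\cdot|_p$ normalized by $|p|_p=p^{-1}$, and $\mathbb{Z}_p=\{x\in\mathbb{Q}_p:|x|_p\le 1\}$. The operator $\delta$ is the Fermat quotient operator $\delta y=(y-y^p)/p$, applied formally to polynomials in $u$ with $\mathbb{Q}_p$-coefficients, and $\delta^k$ is its $k$-th iterate ($\delta^0$ is the identity). *)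

(* Defs.v *)
(* No p-adic library is installed, so Q_p is pinned down
   axiomatically (up to isometric isomorphism) as a field K with an
   absolute value that is non-archimedean, normalized by |p| = 1/p,
   complete, and in which Q is dense.  Any such (K, abs) is isometrically
   isomorphic to (Q_p, |.|_p) (Ostrowski + uniqueness of completions);
   Q_p itself is such a model. *)
From mathcomp Require Import all_boot all_order all_algebra.
Set Implicit Arguments. Unset Strict Implicit. Unset Printing Implicit Defensive.
Import Order.TTheory GRing.Theory Num.Theory.
Local Open Scope ring_scope.

Record is_Qp_model (p : nat) (K : fieldType) (abs : K -> rat) : Prop := {
  abs_ge0   : forall x, 0 <= abs x;
  abs_eq0   : forall x, abs x = 0 <-> x = 0;
  absM      : forall x y, abs (x * y) = abs x * abs y;
  abs_ultra : forall x y, abs (x + y) <= Num.max (abs x) (abs y);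
  abs_p     : abs (p%:R) = (p%:Q)^-1;
  Q_dense   : forall (x : K) (e : rat), 0 < e ->
                exists q : rat, abs (x - ratr q) < e;
  complete  : forall u : nat -> K,
                (forall e : rat, 0 < e -> exists N : nat, forall m l : nat,
                   (N <= m)%N -> (N <= l)%N -> abs (u m - u l) < e) ->
                exists L : K, forall e : rat, 0 < e -> exists N : nat,
                   forall m : nat, (N <= m)%N -> abs (u m - L) < e }.

Definition fermat_delta (p : nat) (K : fieldType) (y : {poly K}) : {poly K} :=
  (p%:R)^-1 *: (y - y ^+ p).

Definition delta_iter (p : nat) (K : fieldType) (k n : nat) (a : K) : {poly K} :=
  iter k (@fermat_delta p K) (a%:P + (p ^ n)%:R *: 'X).

Arguments is_Qp_model : clear implicits.

(* Main.v *)
(* Write P = P_0 + Q with Q(0) = 0.  By the binomial theorem, (P_0 + Q)^p agrees with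
   P_0^p + Q^p up to multiples of p, and Q^p has no monomial of degree < p.  So if
   |P_j| <= p^(-m j) for j >= 1, then the coefficients of P^p in degree j >= 1 obey the
   same bound, and in degree 1 even p^(-m-1) < |P_1|.  Dividing P - P^p by p thus gives
   |delta(P)_1| = p |P_1| and costs one power of p in every other coefficient, i.e.
   n - k drops by one per iteration.  The constant term stays integral because
   |x - x^p| <= 1/p on Z_p: approximate x modulo p by a natural number (Q is dense and
   denominators prime to p are invertible mod p) and apply Fermat's little theorem. *)

Require Import Defs.
From mathcomp Require Import all_boot all_order all_algebra.
From mathcomp Require Import zify ring.

Set Implicit Arguments.
Unset Strict Implicit.
Unset Printing Implicit Defensive.

Import Order.TTheory GRing.Theory Num.Theory.
Local Open Scope ring_scope.

Record nonarchimedean_abs (K : fieldType) (abs : K -> rat) : Prop := {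
  nabs_ge0 : forall x, 0 <= abs x;
  nabs_eq0 : forall x, abs x = 0 <-> x = 0;
  nabsM : forall x y, abs (x * y) = abs x * abs y;
  nabs_ultra : forall x y, abs (x + y) <= Num.max (abs x) (abs y) }.

Lemma Qp_model_nonarchimedean p (K : fieldType) (abs : K -> rat) :
  is_Qp_model p K abs -> nonarchimedean_abs abs.
Proof. by case. Qed.

Lemma coef_exp_eq0 (R : nzRingType) (Q : {poly R}) n j :
  Q`_0 = 0 -> (j < n)%N -> (Q ^+ n)`_j = 0.
Proof.
move=> Q0; elim: n j => // n IHn j lt_j_Sn.
rewrite exprS coefM big1 // => -[[|i] /=]; rewrite ltnS => le_ij _.
  by rewrite Q0 mul0r.
by rewrite IHn ?mulr0 //; lia.
Qed.

Section Nonarchimedean.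
Variables (K : fieldType) (abs : K -> rat).
Hypothesis Habs : nonarchimedean_abs abs.

Lemma abs0 : abs 0 = 0. Proof. exact/(nabs_eq0 Habs). Qed.

Lemma abs1 : abs 1 = 1.
Proof.
have abs1_neq0 : abs 1 != 0 by apply/eqP => /(nabs_eq0 Habs)/eqP; rewrite oner_eq0.
by apply: (mulfI abs1_neq0); rewrite -(nabsM Habs) !mulr1.
Qed.

Lemma absN x : abs (- x) = abs x.
Proof.
have absN1 : abs (-1) = 1.
  apply/eqP; rewrite -(sqrp_eq1 (nabs_ge0 Habs _)) expr2 -(nabsM Habs).
  by rewrite mulrNN mulr1 abs1.
by rewrite -mulN1r (nabsM Habs) absN1 mul1r.
Qed.

Lemma absX x n : abs (x ^+ n) = abs x ^+ n.
Proof. by elim: n => [|n IHn]; rewrite ?abs1 // !exprS (nabsM Habs) IHn. Qed.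

Lemma absV x : abs x^-1 = (abs x)^-1.
Proof.
have [->|x_neq0] := eqVneq x 0; first by rewrite invr0 abs0 invr0.
have absx_neq0 : abs x != 0.
  by apply/eqP => /(nabs_eq0 Habs)/eqP; rewrite (negPf x_neq0).
have absxV : abs x * abs x^-1 = 1 by rewrite -(nabsM Habs) divff ?abs1.
by rewrite -[LHS](mulKf absx_neq0) absxV mulr1.
Qed.

Lemma absB_le x y : abs (x - y) <= Num.max (abs x) (abs y).
Proof. by rewrite -(absN y); apply: (nabs_ultra Habs). Qed.

Lemma abs_sum_le (I : Type) (r : seq I) (P : pred I) (F : I -> K) b :
  0 <= b -> (forall i, P i -> abs (F i) <= b) ->
  abs (\sum_(i <- r | P i) F i) <= b.
Proof.
move=> b_ge0 F_le; apply: (big_ind (fun x => abs x <= b)) => //.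
  by rewrite abs0.
move=> x y x_le y_le; apply: le_trans (nabs_ultra Habs x y) _.
by rewrite ge_max x_le y_le.
Qed.

Lemma abs_natr_le1 n : abs (n%:R : K) <= 1.
Proof.
elim: n => [|n IHn]; first by rewrite abs0.
rewrite -addn1 natrD; apply: le_trans (nabs_ultra Habs _ _) _.
by rewrite ge_max abs1 lexx IHn.
Qed.

Lemma abs_intr (z : int) : abs (z%:~R : K) = abs (`|z|%N%:R).
Proof. by case: z => n; rewrite ?NegzE ?mulrNz ?absN -pmulrn. Qed.

Lemma abs_intr_le1 (z : int) : abs (z%:~R : K) <= 1.
Proof. by rewrite abs_intr abs_natr_le1. Qed.

Lemma absMn_le x n : abs (x *+ n) <= abs x.
Proof.
by rewrite -mulr_natr (nabsM Habs) ler_piMr ?(nabs_ge0 Habs) ?abs_natr_le1.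
Qed.

Lemma absD_eq x y : abs y < abs x -> abs (x + y) = abs x.
Proof.
move=> lt_yx; apply/eqP; rewrite eq_le; apply/andP; split.
  by apply: le_trans (nabs_ultra Habs _ _) _; rewrite ge_max lexx ltW.
have := absB_le (x + y) y; rewrite addrK le_max => /orP[//|].
by rewrite leNgt lt_yx.
Qed.

Lemma absXB_le x y n :
  abs x <= 1 -> abs y <= 1 -> abs (x ^+ n - y ^+ n) <= abs (x - y).
Proof.
move=> x_le1 y_le1; rewrite subrXX (nabsM Habs) ler_piMr ?(nabs_ge0 Habs) //.
apply: abs_sum_le => // i _; rewrite (nabsM Habs) !absX.
by rewrite mulr_ile1 ?exprn_ge0 ?exprn_ile1 ?(nabs_ge0 Habs).
Qed.

Section CoefBound.
Variables (r : rat) (m : int).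
Hypothesis r_gt0 : 0 < r.

Definition coef_bound (P : {poly K}) := forall j : nat, abs P`_j <= r ^ (m * j).

Lemma coef_boundM P Q : coef_bound P -> coef_bound Q -> coef_bound (P * Q).
Proof.
move=> P_le Q_le j; rewrite coefM; apply: abs_sum_le; first exact: exprz_ge0 (ltW _).
move=> [i /=]; rewrite ltnS => le_ij _; rewrite (nabsM Habs).
have -> : m * j = m * i + m * (j - i)%N by rewrite -subzn //; ring.
rewrite expfzDr ?gt_eqF //.
by apply: ler_pM; rewrite ?(nabs_ge0 Habs).
Qed.

Lemma coef_boundX P n : coef_bound P -> coef_bound (P ^+ n).
Proof.
move=> P_le; elim: n => [|n IHn]; last by rewrite exprS; apply: coef_boundM.
move=> [|j]; rewrite coef1 /=; first by rewrite abs1 mulr0 expr0z.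
by rewrite abs0 exprz_ge0 ?ltW.
Qed.

End CoefBound.

End Nonarchimedean.

Section Padic.
Variables (p : nat) (K : fieldType) (abs : K -> rat).
Hypotheses (p_prime : prime p) (HK : is_Qp_model p K abs).
Let Habs := Qp_model_nonarchimedean HK.
Local Notation pq := (p%:Q).
Local Notation pinv := (pq^-1).

Lemma pq_gt1 : 1 < pq. Proof. by rewrite ltr1n prime_gt1. Qed.
Lemma pq_neq0 : pq != 0. Proof. by rewrite gt_eqF // (lt_trans ltr01 pq_gt1). Qed.
Lemma pinv_gt0 : 0 < pinv. Proof. by rewrite invr_gt0 (lt_trans ltr01 pq_gt1). Qed.
Lemma pinv_lt1 : pinv < 1.
Proof. by rewrite invf_lt1 ?pq_gt1 ?(lt_trans ltr01 pq_gt1). Qed.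

Lemma pinvXz_le z1 z2 : z1 <= z2 -> pinv ^ z2 <= pinv ^ z1.
Proof. by move=> le_z; rewrite !exprz_inv ler_eXz2l ?pq_gt1 // lerN2. Qed.

Lemma pinvXz_lt z1 z2 : z1 < z2 -> pinv ^ z2 < pinv ^ z1.
Proof. by move=> lt_z; rewrite !exprz_inv ltr_eXz2l ?pq_gt1 // ltrN2. Qed.

Lemma mul_pq_pinvXz z : pq * pinv ^ z = pinv ^ (z - 1).
Proof. by rewrite expfzDr ?gt_eqF ?pinv_gt0 // exprN1 invrK mulrC. Qed.

Lemma abs_mulrp x : abs (x * p%:R) = abs x * pinv.
Proof. by rewrite (nabsM Habs) (abs_p HK). Qed.

Lemma abs_intr_dvd z : (p %| z)%Z -> abs (z%:~R : K) <= pinv.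
Proof.
move=> /dvdzP[k ->].
by rewrite intrM abs_mulrp ler_piMl ?(abs_intr_le1 Habs) ?ltW ?pinv_gt0.
Qed.

Lemma abs_intr_coprime z : coprimez z p -> abs (z%:~R : K) = 1.
Proof.
move=> /coprimezP[[u v] /= Bezout_uv].
apply/eqP; rewrite eq_le (abs_intr_le1 Habs) leNgt /=; apply/negP => lt_z1.
have : abs ((u * z + v * p)%:~R : K) < 1.
  rewrite intrD !intrM; apply: le_lt_trans (nabs_ultra Habs _ _) _.
  rewrite gt_max abs_mulrp (nabsM Habs).
  rewrite (le_lt_trans (ler_piMl _ (abs_intr_le1 Habs _)) lt_z1)
    ?(nabs_ge0 Habs) //=.
  by rewrite (le_lt_trans _ pinv_lt1) // ler_piMl ?(abs_intr_le1 Habs) ?ltW ?pinv_gt0.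
by rewrite Bezout_uv (abs1 Habs) ltxx.
Qed.

Lemma abs_natr_gt0 n : (0 < n)%N -> 0 < abs (n%:R : K).
Proof.
move=> n_gt0; have [m cop_pm ->] := pfactor_coprime p_prime n_gt0.
rewrite natrM natrX (nabsM Habs) (absX Habs) (abs_p HK).
rewrite mulr_gt0 ?exprn_gt0 ?pinv_gt0 //.
by rewrite -[m%:R]/((Posz m)%:~R) abs_intr_coprime ?ltr01 // coprimezE coprime_sym.
Qed.

Lemma abs_ratr_le1_coprime_den q : abs (ratr q : K) <= 1 -> coprimez (denq q) p.
Proof.
move=> q_le1; rewrite coprimezE coprime_sym prime_coprime //; apply/negP => p_dvd_den.
have num_unit : abs ((numq q)%:~R : K) = 1.
  apply: abs_intr_coprime; rewrite coprimezE.
  exact: coprime_dvdr p_dvd_den (coprime_num_den q).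
have den_gt0 : 0 < abs ((denq q)%:~R : K).
  by rewrite (abs_intr Habs) abs_natr_gt0 // absz_gt0 denq_neq0.
have den_le : abs ((denq q)%:~R : K) <= pinv by apply: abs_intr_dvd.
move: q_le1; rewrite /ratr (nabsM Habs) (absV Habs) num_unit mul1r.
rewrite invr_le1 ?unitf_gt0 // leNgt (le_lt_trans den_le pinv_lt1) //.
Qed.

Lemma ratr_approx_nat q :
  abs (ratr q : K) <= 1 -> exists N : nat, abs (ratr q - N%:R : K) <= pinv.
Proof.
move=> /abs_ratr_le1_coprime_den cop; have den_unit := abs_intr_coprime cop.
have [[u v] /= Bezout_uv] := coprimezP _ _ cop.
set r := numq q in Bezout_uv *; set s := denq q in cop den_unit Bezout_uv *.
(* N represents r / s modulo p, since u inverts s modulo p. *)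
pose N := `|(r * u %% p)%Z|%N.
have N_def : (N : int) = r * u - (r * u %/ p)%Z * p.
  by rewrite gez0_abs // modz_ge0 // eqz_nat -lt0n prime_gt0.
have s_neq0 : (s%:~R : K) != 0.
  apply/eqP => s0; move: den_unit.
  by rewrite s0 (abs0 Habs) => /eqP; rewrite eq_sym oner_eq0.
have num_eq : r - (N : int) * s = (r * v + (r * u %/ p)%Z * s) * p.
  by rewrite N_def -{1}[r]mulr1 -Bezout_uv; ring.
exists N.
have -> : (ratr q - N%:R : K) = (r - (N : int) * s)%:~R / s%:~R.
  by rewrite /ratr -/r -/s intrB intrM; field.
rewrite num_eq (nabsM Habs) (absV Habs) den_unit invr1 mulr1 intrM abs_mulrp.
by rewrite ler_piMl ?(abs_intr_le1 Habs) ?ltW ?pinv_gt0.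
Qed.

Lemma abs_le1_approx_nat x :
  abs x <= 1 -> exists N : nat, abs (x - N%:R) <= pinv.
Proof.
move=> x_le1; have [q q_near] := Q_dense HK x pinv_gt0.
have q_le1 : abs (ratr q : K) <= 1.
  rewrite -[ratr q](subKr x); apply: le_trans ((absB_le Habs) _ _) _.
  by rewrite ge_max x_le1 (le_trans (ltW q_near)) ?ltW ?pinv_lt1.
have [N N_near] := ratr_approx_nat q_le1; exists N.
rewrite -(subrK (ratr q) x) -addrA; apply: le_trans (nabs_ultra Habs _ _) _.
by rewrite ge_max N_near ltW.
Qed.

Lemma abs_sub_expp_le x : abs x <= 1 -> abs (x - x ^+ p) <= pinv.
Proof.
move=> x_le1; have [N N_near] := abs_le1_approx_nat x_le1.
have N_fermat : abs (N%:R - N%:R ^+ p : K) <= pinv.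
  rewrite -natrX !pmulrn -intrB; apply: abs_intr_dvd.
  by rewrite -eqz_mod_dvd !modz_nat fermat_little.
have Xp_near : abs (N%:R ^+ p - x ^+ p) <= abs (N%:R - x).
  by rewrite (absXB_le Habs) ?(abs_natr_le1 Habs).
have -> : x - x ^+ p = (x - N%:R) + ((N%:R - N%:R ^+ p) + (N%:R ^+ p - x ^+ p)).
  by ring.
apply: le_trans (nabs_ultra Habs _ _) _; rewrite ge_max N_near /=.
apply: le_trans (nabs_ultra Habs _ _) _; rewrite ge_max N_fermat /=.
by rewrite (le_trans Xp_near) // -opprB (absN Habs).
Qed.

Lemma absMn_dvd x n : (p %| n)%N -> abs (x *+ n) <= abs x * pinv.
Proof.
move=> /dvdnP[k ->]; rewrite mulrnA -[_ *+ p]mulr_natr abs_mulrp.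
by rewrite ler_wpM2r ?(absMn_le Habs) // invr_ge0 ler0n.
Qed.

Lemma coef_addC_expp (c : K) Q m j :
  abs c <= 1 -> coef_bound abs pinv m Q -> (0 < j)%N ->
  abs (((c%:P + Q) ^+ p)`_j - (Q ^+ p)`_j) <= pinv ^ (m * j + 1).
Proof.
move=> c_le1 Q_le j_gt0.
rewrite exprDn big_ord_recr /= subnn expr0 mul1r binn mulr1n coefD addrK coef_sum.
apply: (abs_sum_le Habs); first exact/ltW/exprz_gt0/pinv_gt0.
move=> i _; rewrite coefMn -polyC_exp coefCM.
have [->|i_gt0] := posnP i.
  rewrite expr0 coef1 gtn_eqF // mulr0 mul0rn (abs0 Habs).
  by rewrite ltW ?exprz_gt0 ?pinv_gt0.
have p_dvd_bin : (p %| 'C(p, i))%N by apply: prime_dvd_bin => //; rewrite i_gt0 ltn_ord.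
apply: le_trans (absMn_dvd _ p_dvd_bin) _.
rewrite expfzDr ?gt_eqF ?pinv_gt0 // expr1z ler_wpM2r ?invr_ge0 ?ler0n //.
rewrite (nabsM Habs) (absX Habs) (le_trans _ (coef_boundX Habs pinv_gt0 i Q_le j)) //.
by rewrite ler_piMl ?(nabs_ge0 Habs) ?exprn_ile1 ?(nabs_ge0 Habs).
Qed.

(* For m = n - k these are the claims of the theorem; demanding the last bound
   already at j = 1 (where it is implied by the second) makes the invariant stable. *)
Definition delta_coef_bounds (m : int) (P : {poly K}) :=
  [/\ abs P`_0 <= 1, abs P`_1 = pinv ^ m &
      forall j : nat, (0 < j)%N -> abs P`_j <= pinv ^ ((m + 1) * j - 1)].

Lemma delta_coef_bounds_affine (n : nat) a :
  abs a <= 1 -> delta_coef_bounds n (a%:P + (p ^ n)%:R *: 'X).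
Proof.
have abs_pn : abs ((p ^ n)%:R : K) = pinv ^ n.
  by rewrite natrX (absX Habs) (abs_p HK) exprVn exprnN exprz_inv.
move=> a_le1; split => [||[|[|j]] //].
- by rewrite coefD coefC coefZ coefX mulr0 addr0.
- by rewrite coefD coefC coefZ coefX mulr1 add0r abs_pn.
- by rewrite coefD coefC coefZ coefX mulr1 add0r abs_pn mulr1 addrK.
- rewrite coefD coefC coefZ coefX mulr0 addr0 (abs0 Habs).
  by rewrite ltW ?exprz_gt0 ?pinv_gt0.
Qed.

Lemma delta_coef_bounds_step m P :
  delta_coef_bounds m P -> delta_coef_bounds (m - 1) (fermat_delta p P).
Proof.
case=> P0_le P1_eq Pj_le.
pose Q := P - (P`_0)%:P.
have Q0 : Q`_0 = 0 by rewrite coefB coefC subrr.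
have Q_le : coef_bound abs pinv m Q.
  case=> [|j]; first by rewrite Q0 (abs0 Habs) ltW ?exprz_gt0 ?pinv_gt0.
  by rewrite coefB coefC /= subr0 (le_trans (Pj_le _ _)) // pinvXz_le //; lia.
have PQ : P = (P`_0)%:P + Q by rewrite addrC subrK.
have Pp_le j : (0 < j)%N -> abs (P ^+ p)`_j <= pinv ^ (m * j).
  move=> j_gt0; rewrite -(subrK (Q ^+ p)`_j (P ^+ p)`_j).
  apply: le_trans (nabs_ultra Habs _ _) _.
  rewrite ge_max (coef_boundX Habs pinv_gt0 p Q_le j) andbT {1}PQ.
  by rewrite (le_trans (coef_addC_expp P0_le Q_le j_gt0)) // pinvXz_le //; lia.
have Pp1_lt : abs (P ^+ p)`_1 < pinv ^ m.
  have Qp1 : (Q ^+ p)`_1 = 0 by rewrite coef_exp_eq0 ?prime_gt1.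
  have := coef_addC_expp P0_le Q_le (ltnSn 0); rewrite -PQ Qp1 subr0.
  by move/le_lt_trans; apply; rewrite pinvXz_lt // mulr1 ltrDl.
have coef_delta j : abs (fermat_delta p P)`_j = pq * abs (P`_j - (P ^+ p)`_j).
  by rewrite /fermat_delta coefZ coefB (nabsM Habs) (absV Habs) (abs_p HK) invrK.
split => [||j j_gt0]; rewrite coef_delta.
- rewrite -!horner_coef0 horner_exp horner_coef0 -[X in _ <= X](mulfV pq_neq0).
  by rewrite ler_wpM2l ?ler0n ?abs_sub_expp_le.
- by rewrite (absD_eq Habs) ?(absN Habs) P1_eq ?mul_pq_pinvXz.
- rewrite subrK -mul_pq_pinvXz ler_wpM2l ?ler0n //.
  apply: le_trans (absB_le Habs _ _) _; rewrite ge_max Pp_le // andbT.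
  by rewrite (le_trans (Pj_le _ _)) // pinvXz_le //; lia.
Qed.

Lemma delta_iter_coef_bounds k n a :
  abs a <= 1 -> delta_coef_bounds (n%:Z - k%:Z) (delta_iter p k n a).
Proof.
move=> a_le1; elim: k => [|k IHk].
  by rewrite subr0; apply: delta_coef_bounds_affine.
have -> : n%:Z - k.+1%:Z = n%:Z - k%:Z - 1 by rewrite -addn1 PoszD; ring.
exact: delta_coef_bounds_step.
Qed.

End Padic.

Theorem lemma2p1 (p : nat) (K : fieldType) (abs : K -> rat)
    (Hp : prime p) (HK : is_Qp_model p K abs)
    (n k : nat) (a : K) (Ha : abs a <= 1) :
  let c := fun j : nat => (delta_iter p k n a)`_j in
  [/\ abs (c 0%N) <= 1,
      abs (c 1%N) = (p%:Q) ^ (- (n%:Z - k%:Z)) &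
      forall j : nat, (2 <= j <= p ^ k)%N ->
        abs (c j) <= (p%:Q) ^ (- ((n%:Z - k%:Z + 1) * j%:Z - 1))].
Proof.
move=> c; have [c0_le c1_eq cj_le] := delta_iter_coef_bounds Hp HK k n Ha.
split => [||j /andP[j_ge2 _]]; rewrite -?exprz_inv //.
exact/cj_le/ltnW.
Qed.
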